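(* Let $G<\operatorname{Aut}(\mathcal T)$ be a countable weakly branch group acting spherically transitively on a regular rooted tree $\mathcal T=\Sigma^*$. Then there are uncountably many pairwise non-equivalent representations of the form $\rho_{G/P}$, where $P$ is a parabolic subgroup of $G$.
   Context: $\Sigma$ is a finite alphabet; $\mathcal T=\Sigma^*$ is the regular rooted tree of finite words over $\Sigma$, with boundary $\partial\mathcal T=\Sigma^{\mathbb N}$. $G$ is spherically transitive if it acts transitively on $\Sigma^n$ for all $n$. The rigid stabilizer $\operatorname{Rist}_G(\sigma)$ of a vertex $\sigma$ is the subgroup of elements of $G$ that act trivially on all words not starting with $\sigma$ and act on words starting with $\sigma$ as $\sigma\tau\mapsto\sigma g(\tau)$ for some $g\in G$. $G$ is weakly branch if all its rigid stabilizers are non-trivial. A parabolic subgroup of $G$ is a subgroup of the form $P_e=\operatorname{Stab}_G(e)$ for a ray $e\in\Sigma^{\mathbb N}$. $\rho_{G/P}$ is the quasi-regular unitary representation of the discrete group $G$ on $\ell^2(G/P)$; equivalence means unitary equivalence. *)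

(* Defs.v *)
From HB Require Import structures.
From mathcomp Require Import all_boot all_order all_algebra.
From mathcomp Require Import all_classical all_reals esum.
From mathcomp Require Import complex ring.

Set Implicit Arguments.
Unset Strict Implicit.
Unset Printing Implicit Defensive.

Import Order.TTheory GRing.Theory Num.Theory.
Import ComplexField.

Local Open Scope classical_set_scope.
Local Open Scope ring_scope.

Section TreeAut.
Variable Sigma : finType.
Implicit Types (g h : seq Sigma -> seq Sigma) (u v w : seq Sigma).

Definition tree_adj u v : bool :=
  [exists x, (v == rcons u x) || (u == rcons v x)].

Definition is_tree_aut g : Prop :=
  [/\ bijective g, g [::] = [::] & forall u v, tree_adj (g u) (g v) = tree_adj u v].

Definition tree_aut := {g | `[< is_tree_aut g >]}.

HB.instance Definition _ := Choice.on tree_aut.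

Definition tree_aut_fun (g : tree_aut) : seq Sigma -> seq Sigma := sval g.
Coercion tree_aut_fun : tree_aut >-> Funclass.

Lemma tree_autP (g : tree_aut) : is_tree_aut g.
Proof. by case: g => g /= /asboolP. Qed.

Lemma tree_autE (g h : tree_aut) : g =1 h -> g = h.
Proof. by move=> gh; apply/val_inj/funext. Qed.

Lemma is_tree_aut_id : is_tree_aut id.
Proof. by split => //; exists id. Qed.

Lemma is_tree_aut_comp g h :
  is_tree_aut g -> is_tree_aut h -> is_tree_aut (g \o h).
Proof.
move=> [bg g0 ag] [bh h0 ah]; split; first exact: bij_comp.
- by rewrite /= h0.
- by move=> u v /=; rewrite ag ah.
Qed.

Lemma tree_aut_inv_ex (g : tree_aut) :
  exists2 h : tree_aut, cancel g h & cancel h g.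
Proof.
have [[h gK hK] g0 ag] := tree_autP g.
have hP : is_tree_aut h.
  split; first by exists g.
  - by rewrite -g0 gK.
  - by move=> u v; rewrite -ag !hK.
by exists (exist _ h (introT (asboolP _) hP)).
Qed.

Definition tree_aut_one : tree_aut :=
  exist _ id (introT (asboolP _) is_tree_aut_id).
(* Left action: (g * h) w = g (h w). *)
Definition tree_aut_mul (g h : tree_aut) : tree_aut :=
  exist _ (g \o h)
    (introT (asboolP _) (is_tree_aut_comp (tree_autP g) (tree_autP h))).
Definition tree_aut_inv (g : tree_aut) : tree_aut := s2val (cid2 (tree_aut_inv_ex g)).

Lemma tree_aut_mulA : associative tree_aut_mul.
Proof. by move=> *; apply: tree_autE. Qed.
Lemma tree_aut_mul1 : left_id tree_aut_one tree_aut_mul.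
Proof. by move=> *; apply: tree_autE. Qed.
Lemma tree_aut_mulr1 : right_id tree_aut_one tree_aut_mul.
Proof. by move=> *; apply: tree_autE. Qed.
Lemma tree_aut_mulV : left_inverse tree_aut_one tree_aut_inv tree_aut_mul.
Proof.
move=> g; apply: tree_autE => w.
by rewrite /tree_aut_inv; case: cid2 => h /= gK _; apply: gK.
Qed.
Lemma tree_aut_mulrV : right_inverse tree_aut_one tree_aut_inv tree_aut_mul.
Proof.
move=> g; apply: tree_autE => w.
by rewrite /tree_aut_inv; case: cid2 => h /= _ hK; apply: hK.
Qed.

HB.instance Definition _ := isGroup.Build tree_aut
  tree_aut_mulA tree_aut_mul1 tree_aut_mulr1 tree_aut_mulV tree_aut_mulrV.

(* The image of the ray e is the ray whose prefix of length n is the image of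
   the prefix of length n of e; the default value of [last] is never used. *)
Definition ray_act (g : tree_aut) (e : nat -> Sigma) : nat -> Sigma :=
  fun n => last (e n) (g (mkseq e n.+1)).

End TreeAut.

Section SubgroupType.
Variables (gT : groupType) (G : groupClosed gT).

Definition subgroup_of := {g : gT | g \in G}.

HB.instance Definition _ := SubChoice.on subgroup_of.

Lemma subgroup_of_closed : group_closed G.
Proof. by split; [exact: gpred1 | exact: gpredF]. Qed.

HB.instance Definition _ :=
  SubChoice_isSubGroup.Build gT (mem G) subgroup_of subgroup_of_closed.

End SubgroupType.

Section WeaklyBranch.
Variables (Sigma : finType) (G : groupClosed (tree_aut Sigma)).

Definition spherically_transitive : Prop :=
  forall (n : nat) (u v : n.-tuple Sigma),
    exists2 g : tree_aut Sigma, g \in G & g u = v :> seq Sigma.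

Definition rist (s : seq Sigma) : set (tree_aut Sigma) :=
  [set h : tree_aut Sigma | [/\ h \in G,
               forall w, ~~ prefix s w -> h w = w &
               exists2 g : tree_aut Sigma, g \in G &
                 forall t, h (s ++ t) = s ++ g t]].

Definition weakly_branch : Prop :=
  forall s : seq Sigma, rist s <> [set 1%g].

Definition ray_stab (e : nat -> Sigma) : set (subgroup_of G) :=
  [set g | ray_act (val g) e = e].

Definition parabolic : set (set (subgroup_of G)) := range ray_stab.

End WeaklyBranch.

Arguments ray_stab {Sigma} G e _.
Arguments parabolic {Sigma} G _.

Section L2.
Variables (R : realType) (X : choiceType).
Implicit Types f g : X -> R[i]^o.

Definition sq_summable f : Prop :=
  (\esum_(x in [set: X]) (Normc.normc (f x) ^+ 2)%:E < +oo)%E.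

Definition l2_pred : {pred X -> R[i]^o} := fun f => `[< sq_summable f >].

Lemma sq_summable0 : sq_summable 0.
Proof.
rewrite /sq_summable esum1 ?ltry// => x _.
by rewrite [(0 : X -> R[i]^o) x]/(0 : R[i]) Normc.normc0 expr0n.
Qed.

Lemma esum_natmul_lty (h : X -> R) (n : nat) : (forall x, 0 <= h x) ->
  (\esum_(x in [set: X]) (h x)%:E < +oo)%E ->
  (\esum_(x in [set: X]) (h x *+ n)%:E < +oo)%E.
Proof.
move=> h0 hoo; elim: n => [|n IH].
  by rewrite esum1 ?ltry.
under eq_esum do rewrite mulrS EFinD.
rewrite esumD ?lte_add_pinfty// => x _; rewrite lee_fin//.
by rewrite mulrn_wge0.
Qed.

Lemma sq_summableZ (a : R[i]) f : sq_summable f -> sq_summable (a *: f).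
Proof.
move=> sf; set c := Normc.normc a ^+ 2.
pose n := (Num.truncn c).+1.
apply: le_lt_trans (@esum_natmul_lty (fun x => Normc.normc (f x) ^+ 2) n _ sf).
  apply: le_esum => x _; rewrite lee_fin.
  rewrite [(a *: f) x]/(a * f x : R[i]) Normc.normcM exprMn -mulr_natl.
  by apply: ler_wpM2r; rewrite ?sqr_ge0// ltW// truncnS_gt.
by move=> x; exact: sqr_ge0.
Qed.

Lemma sqr_normc (z : R[i]) : Normc.normc z ^+ 2 =
  complex.Re z ^+ 2 + complex.Im z ^+ 2.
Proof. by case: z => a b; rewrite sqr_sqrtr ?addr_ge0 ?sqr_ge0. Qed.

Lemma sq_summableD f g :
  sq_summable f -> sq_summable g -> sq_summable (f + g).
Proof.
move=> sf sg.
have n0 k x : 0 <= Normc.normc ((k : X -> R[i]) x) ^+ 2 by exact: sqr_ge0.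
have sf2 := esum_natmul_lty 2 (n0 f) sf.
have sg2 := esum_natmul_lty 2 (n0 g) sg.
apply: le_lt_trans (lte_add_pinfty sf2 sg2).
rewrite -esumD; last 2 first.
- by move=> x _; rewrite lee_fin mulrn_wge0.
- by move=> x _; rewrite lee_fin mulrn_wge0.
apply: le_esum => x _; rewrite -EFinD lee_fin.
rewrite [(f + g) x]/(f x + g x : R[i]) !sqr_normc.
case: (f x) => a b; case: (g x) => c d /=.
rewrite -subr_ge0.
have -> : (a ^+ 2 + b ^+ 2) *+ 2 + (c ^+ 2 + d ^+ 2) *+ 2
   - ((a + c) ^+ 2 + (b + d) ^+ 2) = (a - c) ^+ 2 + (b - d) ^+ 2 by ring.
by rewrite addr_ge0 ?sqr_ge0.
Qed.

Lemma l2_submod_closed : submod_closed l2_pred.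
Proof.
split; first exact/asboolP/sq_summable0.
move=> a f g /asboolP sf /asboolP sg; apply/asboolP/sq_summableD => //.
exact: sq_summableZ.
Qed.

HB.instance Definition _ :=
  GRing.isSubmodClosed.Build R[i] (X -> R[i]^o) l2_pred l2_submod_closed.

Definition l2 := {f : X -> R[i]^o | f \in l2_pred}.

HB.instance Definition _ := SubChoice.on l2.
HB.instance Definition _ := [SubChoice_isSubLmodule of l2 by <:].

Definition l2_fun (f : l2) : X -> R[i] := sval f.
Coercion l2_fun : l2 >-> Funclass.

(* Meaningful only for absolutely summable families, which the products of two
   elements of l2 are. *)
Definition rsum (h : X -> R) : R :=
  fine (\esum_(x in [set: X]) (Num.max (h x) 0)%:E) -
  fine (\esum_(x in [set: X]) (Num.max (- h x) 0)%:E).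

Definition csum (h : X -> R[i]) : R[i] :=
  Complex (rsum (fun x => complex.Re (h x))) (rsum (fun x => complex.Im (h x))).

Definition l2_inner (f g : l2) : R[i] := csum (fun x => f x * conjc (g x)).

End L2.

Definition is_unitary (R : realType) (X Y : choiceType)
    (U : {linear l2 R X -> l2 R Y}) : Prop :=
  (forall f g, l2_inner (U f) (U g) = l2_inner f g) /\
  (forall h, exists f, U f = h).

Record unitary_rep (R : realType) (gT : groupType) (X : choiceType) := UnitaryRep {
  rep_op :> gT -> {linear l2 R X -> l2 R X};
  rep_unitary : forall g, is_unitary (rep_op g);
  rep1 : forall f, rep_op 1%g f = f;
  repM : forall g h f, rep_op (g * h)%g f = rep_op g (rep_op h f) }.

Definition unitarily_equivalent (R : realType) (gT : groupType) (X Y : choiceType)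
    (rho : unitary_rep R gT X) (rho' : unitary_rep R gT Y) : Prop :=
  exists U : {linear l2 R X -> l2 R Y},
    is_unitary U /\ forall g f, U (rho g f) = rho' g (U f).

Section QuasiRegular.
Variables (R : realType) (gT : groupType) (P : set gT).

Definition lcoset (g : gT) : set gT := [set (g * p)%g | p in P].

Definition coset_space : choiceType := set_type (range lcoset).

Lemma ltrans_subproof (g : gT) (c : coset_space) :
  [set (g * x)%g | x in val c] \in range lcoset.
Proof.
case: c => c /= /set_mem [h _ <-]; apply/mem_set; exists (g * h)%g => //.
apply/seteqP; split=> [_ [p Pp <-]|_ [_ [p Pp <-] <-]].
  by exists (h * p)%g; [exists p | rewrite mulgA].
by exists p; rewrite ?mulgA.
Qed.

Definition ltrans (g : gT) (c : coset_space) : coset_space :=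
  exist _ [set (g * x)%g | x in val c] (ltrans_subproof g c).

Lemma ltrans1 c : ltrans 1%g c = c.
Proof.
apply/val_inj/seteqP; split=> [_ [x cx <-]|x cx] /=; first by rewrite mul1g.
by exists x; rewrite ?mul1g.
Qed.

Lemma ltransM g h c : ltrans (g * h)%g c = ltrans g (ltrans h c).
Proof.
apply/val_inj/seteqP; split=> [_ [x cx <-]|_ [_ [x cx <-] <-]] /=.
  by exists (h * x)%g; [exists x | rewrite mulgA].
by exists x; rewrite ?mulgA.
Qed.

Lemma ltrans_bij g : set_bij [set: coset_space] [set: coset_space] (ltrans g).
Proof.
split=> //.
  move=> c d _ _ gcd; rewrite -(ltrans1 c) -(ltrans1 d) -(mulVg g).
  by rewrite !ltransM gcd.
by move=> c _; exists (ltrans g^-1%g c) => //; rewrite -ltransM mulgV ltrans1.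
Qed.

Lemma reindex_ltrans g (a : coset_space -> \bar R) : (forall c, 0 <= a c)%E ->
  (\esum_(c in [set: coset_space]) a (ltrans g c) =
   \esum_(c in [set: coset_space]) a c)%E.
Proof.
by move=> a0; rewrite (reindex_esum _ _ _ a (ltrans_bij g)).
Qed.

Lemma quasi_regular_subproof (g : gT) (f : l2 R coset_space) :
  ((fun c => f (ltrans g^-1%g c)) : coset_space -> R[i]^o)
    \in @l2_pred R coset_space.
Proof.
apply/asboolP; rewrite /sq_summable.
rewrite (@reindex_ltrans g^-1%g (fun c => (Normc.normc (f c) ^+ 2)%:E)).
  by case: f => f /= /asboolP.
by move=> c; rewrite lee_fin sqr_ge0.
Qed.

(* (rho(g) f)(xP) = f(g^-1 xP) *)
Definition quasi_regular_op (g : gT) (f : l2 R coset_space) : l2 R coset_space :=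
  exist _ (fun c => f (ltrans g^-1%g c)) (quasi_regular_subproof g f).

Lemma quasi_regular_op_linear g : linear (quasi_regular_op g).
Proof. by move=> a f h; apply/val_inj/funext => c. Qed.

HB.instance Definition _ g :=
  GRing.isLinear.Build R[i] (l2 R coset_space) (l2 R coset_space) _
    (quasi_regular_op g) (quasi_regular_op_linear g).

Lemma quasi_regular_op1 f : quasi_regular_op 1%g f = f.
Proof.
by apply/val_inj/funext => c /=; rewrite invg1 ltrans1.
Qed.

Lemma quasi_regular_opM g h f :
  quasi_regular_op (g * h)%g f = quasi_regular_op g (quasi_regular_op h f).
Proof.
by apply/val_inj/funext => c /=; rewrite /l2_fun/= /l2_fun/= invgM ltransM.
Qed.

Lemma quasi_regular_op_unitary g : is_unitary (quasi_regular_op g).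
Proof.
split=> [f h|h]; last first.
  exists (quasi_regular_op g^-1%g h).
  by rewrite [LHS](esym (quasi_regular_opM g g^-1%g h)) mulgV quasi_regular_op1.
have rsumE (k : coset_space -> R) : rsum (k \o ltrans g^-1%g) = rsum k.
  rewrite /rsum; congr (fine _ - fine _).
    apply: (@reindex_ltrans g^-1%g (fun c => (Num.max (k c) 0)%:E)) => c.
    by rewrite lee_fin le_max lexx orbT.
  apply: (@reindex_ltrans g^-1%g (fun c => (Num.max (- k c) 0)%:E)) => c.
  by rewrite lee_fin le_max lexx orbT.
rewrite /l2_inner /csum.
rewrite -(rsumE (fun c => complex.Re (l2_fun f c * conjc (l2_fun h c)))).
by rewrite -(rsumE (fun c => complex.Im (l2_fun f c * conjc (l2_fun h c)))).
Qed.

Definition quasi_regular : unitary_rep R gT coset_space :=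
  UnitaryRep quasi_regular_op_unitary quasi_regular_op1 quasi_regular_opM.

End QuasiRegular.

(* Main.v *)
Require Import Defs.
From mathcomp Require Import all_boot all_order all_algebra.
From mathcomp Require Import all_classical all_reals esum.
From mathcomp Require Import complex.

(** An intertwiner [U] from [l2 (G/P_e)] to [l2 (G/P_e')] sends the indicator
    of the coset [P_e] to a [P_e]-invariant vector of [l2 (G/P_e')], that is,
    to a square summable function on [G/P_e'] that is constant on every
    [P_e]-orbit; it must vanish on every infinite orbit.  The coset space
    [G/P_e'] is the orbit [G e'].  When [e] does not lie in this orbit, all
    [P_e]-orbits on it are infinite ([stab_orbit_infinite]), so the vector is
    zero, although [U] is isometric: the two representations are not equivalent
    ([infinite_orbits_not_equivalent], [parabolics_not_equivalent]).

    The orbits are infinite because of the weakly branch hypothesis.  Let [x] be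
    a ray other than [e].  For every prefix [s] of [x] that is not a prefix of
    [e], the elements of [G] that act only below [s] belong to [P_e].  One of
    them is non-trivial, hence moves some word below [s]; by spherical
    transitivity some element of [G] takes this word to a prefix of [x], and
    conjugation by it gives an element that acts only below [s] and moves [x]
    ([rist_moves_ray]).  Iterating this with longer and longer [s] gives
    infinitely many images of [x], told apart by the length of the prefix they
    share with [x].  In particular the stabilizer of [e] fixes no other ray, so
    [e] can be recovered from [P_e] ([ray_stab_inj]).

    Finally, [G] is countable and the set of rays is not, so there are
    uncountably many [G]-orbits of rays.  The stabilizers of one ray in each
    orbit form the required family. *)

Set Implicit Arguments.
Unset Strict Implicit.
Unset Printing Implicit Defensive.
Import Order.TTheory GRing.Theory Num.Theory.
Local Open Scope classical_set_scope.

(** * Rays and their prefixes *)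

Lemma take_mkseq (T : Type) (e : nat -> T) n m :
  n <= m -> take n (mkseq e m) = mkseq e n.
Proof. by move=> nm; rewrite -map_take take_iota (minn_idPl nm). Qed.

Lemma eq_from_mkseq (T : Type) (e e' : nat -> T) :
  (forall n, mkseq e n = mkseq e' n) -> e = e'.
Proof.
move=> ee'; apply/funext => n.
by have := ee' n.+1; rewrite !mkseqS => /rcons_inj[_].
Qed.

(** * Tree automorphisms acting on words and rays *)

Section TreeAutomorphisms.
Variable Sigma : finType.
Implicit Types (g h : tree_aut Sigma) (u v w : seq Sigma) (e : nat -> Sigma).

Lemma tree_aut_inj g : injective g.
Proof. by have [/bij_inj] := tree_autP g. Qed.

Lemma tree_aut_mulE g h w : tree_aut_fun (g * h)%g w = g (h w).
Proof. by []. Qed.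

Lemma tree_aut_mulKV g : cancel (tree_aut_fun g^-1%g) g.
Proof. by move=> w; rewrite -tree_aut_mulE mulgV. Qed.

(** An automorphism fixes the root and preserves adjacency, so it can only fail
    to take a child of [w] to a child of [g w] by taking it to the parent of
    [g w]; by induction that parent is the image of the parent of [w], and
    injectivity forbids it. *)
Lemma tree_aut_rcons g w x : exists y, g (rcons w x) = rcons (g w) y.
Proof.
have [_ g0 g_adj] := tree_autP g.
(* The two possible positions of the image of a child. *)
have child u z : {y | g (rcons u z) = rcons (g u) y} +
                 {y | g u = rcons (g (rcons u z)) y}.
  have : tree_adj (g (rcons u z)) (g u).
    by rewrite g_adj; apply/existsP; exists z; rewrite eqxx orbT.
  move=> /existsP/sigW[y /orP/orP]; case: eqP => [|_ /eqP] E.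
    by right; exists y.
  by left; exists y.
elim/last_ind: w x => [|w z IHw] x.
  case: (child [::] x) => [[y E]|[y]]; first by exists y.
  by rewrite g0; case: (g _).
case: (child (rcons w z) x) => [[y E]|[y E]]; first by exists y.
have [t wt] := IHw z; move: E; rewrite wt => /rcons_inj[/tree_aut_inj ww _].
have /eqP := congr1 size ww.
by rewrite !size_rcons -[X in X == _]addn0 -addn2 eqn_add2l.
Qed.

Lemma size_tree_aut g w : size (g w) = size w.
Proof.
elim/last_ind: w => [|w x IHw]; first by have [_ -> _] := tree_autP g.
by have [y ->] := tree_aut_rcons g w x; rewrite !size_rcons IHw.
Qed.

Lemma take_tree_aut g n w : take n (g w) = g (take n w).
Proof.
elim/last_ind: w => [|w x IHw].
  by rewrite (size0nil (size_tree_aut g [::])).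
have [nw|wn] := leqP n (size w).
  have [y ->] := tree_aut_rcons g w x.
  by rewrite -!cats1 !takel_cat ?size_tree_aut.
by rewrite !take_oversize ?size_tree_aut ?size_rcons.
Qed.

Lemma prefix_tree_aut g u v : prefix (g u) (g v) = prefix u v.
Proof.
by rewrite !prefixE size_tree_aut take_tree_aut (inj_eq (@tree_aut_inj g)).
Qed.

Lemma mkseq_ray_act g e n : mkseq (ray_act g e) n = g (mkseq e n).
Proof.
elim: n => [|n IHn]; first by rewrite (size0nil (size_tree_aut g [::])).
rewrite mkseqS IHn /ray_act mkseqS.
by have [y ->] := tree_aut_rcons g (mkseq e n) (e n); rewrite last_rcons.
Qed.

Lemma ray_act1 e : ray_act 1%g e = e.
Proof. by apply: eq_from_mkseq => n; rewrite mkseq_ray_act. Qed.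

Lemma ray_actM g h e : ray_act (g * h)%g e = ray_act g (ray_act h e).
Proof. by apply: eq_from_mkseq => n; rewrite !mkseq_ray_act. Qed.

Lemma ray_actK g e : ray_act g^-1%g (ray_act g e) = e.
Proof. by rewrite -ray_actM mulVg ray_act1. Qed.

(** Words of the length of [s] other than [s] itself do not start with [s]; if
    [g s] were one of them, it would be fixed. *)
Lemma tree_aut_subtree_fix g s :
  (forall w, ~~ prefix s w -> g w = w) -> g s = s.
Proof.
move=> gP; apply/eqP/negPn/negP => gs.
have : ~~ prefix s (g s) by rewrite prefixE -(size_tree_aut g s) take_size.
by move=> /gP /tree_aut_inj/eqP; apply/negP.
Qed.

End TreeAutomorphisms.

(** * Weakly branch groups have large stabilizers of rays *)

Section WeaklyBranchGroups.
Variables (Sigma : finType) (G : groupClosed (tree_aut Sigma)).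
Implicit Types (g h k : tree_aut Sigma) (s w : seq Sigma) (e x : nat -> Sigma).

(** The weakly branch hypothesis in a form that survives conjugation: the
    conjugate of [h] by an element of [G] fixing [s] again acts only below [s],
    but it need not act there as an element of [G]. *)
Lemma weakly_branch_move s : weakly_branch G ->
  exists h w, [/\ h \in G, forall w, ~~ prefix s w -> h w = w & h w <> w].
Proof.
move=> /(_ s) wbG; apply/not_existsP => noh; apply: wbG.
apply/seteqP; split => [h [hG hs _]|_ ->] /=.
  apply: tree_autE => w; apply: contrapT => hw.
  by apply: (noh h); exists w.
by split; [exact: gpred1| |exists 1%g => //; exact: gpred1].
Qed.

Lemma weakly_branch_two_letters : weakly_branch G -> exists a b : Sigma, a <> b.
Proof.
move=> /(weakly_branch_move [::])[h [w [_ _ hw]]].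
apply/not_existsP => noa; apply: hw.
have ab (a b : Sigma) : a = b.
  by apply: contrapT => ab; apply: (noa a); exists b.
have := size_tree_aut h w; move: (h w) => w'.
by elim: w' w => [|a u IHu] [|b v]//= [/IHu->]; rewrite (ab a b).
Qed.

Hypotheses (wbG : weakly_branch G) (stG : spherically_transitive G).

(** A conjugate [g h g^-1] of an element [h] that acts only below
    [s := mkseq x n], where [g] takes a word moved by [h] to a prefix of [x].
    That word starts with [s], so [g] fixes [s] and the conjugate still acts
    only below [s]. *)
Lemma rist_moves_ray x n : exists k m,
  [/\ k \in G, forall w, ~~ prefix (mkseq x n) w -> k w = w &
      k (mkseq x m) <> mkseq x m].
Proof.
set s := mkseq x n; have [h [w [hG hs hw]]] := weakly_branch_move s wbG.
have sw : prefix s w by apply: contra_notT hw => /hs.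
have szx : size (mkseq x (size w)) == size w by rewrite size_mkseq.
have [g gG /= gw] := stG (in_tuple w) (Tuple szx).
have gs : g s = s.
  move: sw; rewrite prefixE => /eqP sw.
  rewrite -[in LHS]sw -take_tree_aut gw size_mkseq take_mkseq//.
  by rewrite -(size_mkseq x n) size_prefix// prefixE; apply/eqP.
exists (g * h * g^-1)%g, (size w); split.
- by rewrite !gpredM ?gpredV.
- move=> v sv; rewrite !tree_aut_mulE hs ?tree_aut_mulKV//.
  by rewrite -(prefix_tree_aut g) gs tree_aut_mulKV.
- by rewrite -gw -tree_aut_mulE mulgVK tree_aut_mulE => /tree_aut_inj.
Qed.

(** The elements [k i] act only below the prefix of [x] of length [N i], where
    [N 0] is large enough for this prefix to leave [e] and [N i.+1] is a length
    at which [k i] visibly moves [x]; thus [ray_act (k j) x] agrees with [x] up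
    to length [N i.+1] for [j > i], whereas [ray_act (k i) x] does not. *)
Lemma stab_orbit_infinite e x : x <> e ->
  exists k : nat -> tree_aut Sigma,
    [/\ forall i, k i \in G, forall i, ray_act (k i) e = e &
        injective (fun i => ray_act (k i) x)].
Proof.
move=> xe.
have [n0 xn0] : exists n0, mkseq x n0 <> mkseq e n0.
  by apply/existsNP => /eq_from_mkseq.
have xen n : n0 <= n -> mkseq x n <> mkseq e n.
  move=> nn xn; apply: xn0.
  by rewrite -(take_mkseq x nn) -(take_mkseq e nn) xn.
have /choice[f fP] : forall n, exists km : tree_aut Sigma * nat,
   [/\ km.1 \in G, forall w, ~~ prefix (mkseq x n) w -> km.1 w = w &
      km.1 (mkseq x km.2) <> mkseq x km.2].
  by move=> n; have [k [m ?]] := rist_moves_ray x n; exists (k, m).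
pose y n := ray_act (f n).1 x.
have yfix n : mkseq (y n) n = mkseq x n.
  by rewrite mkseq_ray_act; apply: tree_aut_subtree_fix; have [] := fP n.
have ymove n : mkseq (y n) (f n).2 <> mkseq x (f n).2.
  by rewrite mkseq_ray_act; have [] := fP n.
have ystab n : n0 <= n -> ray_act (f n).1 e = e.
  move=> nn; apply: eq_from_mkseq => m; rewrite mkseq_ray_act.
  have [_ fix_s _] := fP n; rewrite fix_s//; apply/negP => xm.
  apply: (xen _ nn).
  move: (xm); rewrite prefixE size_mkseq => /eqP <-; rewrite take_mkseq//.
  by have := size_prefix xm; rewrite !size_mkseq.
have lt_f n : n < (f n).2.
  rewrite ltnNge; apply/negP => le_n; apply: (ymove n).
  by rewrite -(take_mkseq _ le_n) yfix take_mkseq.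
pose N i := iter i (fun n => (f n).2) n0.
have N_mono : {homo N : i j / i < j}.
  by apply: homo_ltn => [j i k|i]; [exact: ltn_trans|exact: lt_f].
have y_neq i j : i < j -> y (N i) <> y (N j).
  move=> ij yij; apply: (ymove (N i)).
  have le_N : (f (N i)).2 <= N j.
    by move: ij; rewrite leq_eqVlt => /predU1P[<-//|/N_mono/ltnW].
  by rewrite yij -(take_mkseq _ le_N) yfix take_mkseq.
exists (fun i => (f (N i)).1); split=> [i|i|i j /= yij].
- by have [] := fP (N i).
- by apply: ystab; elim: i => [//|i IHi]; exact: leq_trans IHi (ltnW (lt_f _)).
- by case: (ltngtP i j) => // /y_neq []; rewrite /y yij.
Qed.
End WeaklyBranchGroups.

(** * Square summable functions *)

Section SquareSummable.
Local Open Scope ring_scope.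
Variables (R : realType) (X : choiceType).

(** The sum of the squares is at least [n * |a|^2] for every [n]. *)
Lemma sq_summable_infinite_fiber (f : X -> R[i]^o) (c : nat -> X) (a : R[i]) :
  sq_summable f -> injective c -> (forall i, f (c i) = a) -> a = 0.
Proof.
move=> sf cI fc; apply: contrapT => a0; move: sf; rewrite /sq_summable.
have r0 : 0 < Normc.normc a ^+ 2.
  rewrite lt_neqAle sqr_ge0 andbT eq_sym expf_eq0/=.
  by apply/eqP => /Normc.eq0_normc.
pose F x := (Normc.normc (f x) ^+ 2)%:E.
have F_ge n : ((Normc.normc a ^+ 2 *+ n)%:E <= \esum_(x in [set: X]) F x)%E.
  apply: esum_ge; exists (c @` `I_n).
    by split=> //; exact/finite_image/finite_II.
  rewrite fsbig_image/=; last by move=> i j _ _ /cI.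
  rewrite -fsbig_ord /F; under eq_bigr do rewrite fc.
  by rewrite sumEFin sumr_const card_ord.
rewrite -/F; case: (esum _ F) F_ge => [S| |] F_ge.
- move=> _; have := F_ge (Num.truncn (S / Normc.normc a ^+ 2)).+1.
  by rewrite lee_fin leNgt -mulr_natr mulrC -ltr_pdivrMr// truncnS_gt.
- by rewrite ltxx.
- by have := F_ge 0%N.
Qed.

Lemma esum_pred1 (x0 : X) :
  (\esum_(x in [set: X]) (x == x0)%:R%:E)%E = 1%:E :> \bar R.
Proof.
rewrite -[RHS](@esum_set1 R X x0 (fun=> 1%:E)) ?lee_fin// [RHS]esum_mkcond.
by apply: eq_esum => x _; rewrite in_set1; case: eqP.
Qed.

Lemma sq_summable_delta (x0 : X) :
  (fun x => (x == x0)%:R : R[i]^o) \in @l2_pred R X.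
Proof.
apply/asboolP; rewrite /sq_summable.
under eq_esum => x _.
  rewrite (_ : _ ^+ 2 = (x == x0)%:R); last first.
    by case: eqP => _; rewrite (Normc.normc1, Normc.normc0) ?expr1n ?expr0n.
  over.
by rewrite esum_pred1 ltry.
Qed.

Definition l2_delta (x0 : X) : l2 R X :=
  exist _ (fun x => (x == x0)%:R) (sq_summable_delta x0).

Lemma rsum_ge0 (h : X -> R) : (forall x, 0 <= h x) ->
  rsum h = fine (\esum_(x in [set: X]) (h x)%:E).
Proof.
move=> h0; rewrite /rsum [X in _ - fine X]esum1 ?subr0.
  by congr fine; apply: eq_esum => x _; rewrite max_l.
by move=> x _; rewrite max_r ?oppr_le0.
Qed.

Lemma rsum0 : rsum (fun _ : X => 0 : R) = 0.
Proof. by rewrite rsum_ge0// esum1. Qed.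

Lemma l2_inner_delta x0 : l2_inner (l2_delta x0) (l2_delta x0) = 1.
Proof.
transitivity (csum (fun x => (x == x0)%:R : R[i])).
  congr csum; apply/funext => x.
  by rewrite /l2_fun/=; case: eqP => _; rewrite ?mul0r// mul1r conjc1.
have -> : csum (fun x => (x == x0)%:R : R[i]) =
    Complex (rsum (fun x => (x == x0)%:R)) (rsum (fun _ : X => 0)).
  by congr Complex; congr rsum; apply/funext => x; case: eqP.
by rewrite rsum0 rsum_ge0// esum_pred1.
Qed.

Lemma l2_inner0 : l2_inner (0 : l2 R X) 0 = 0.
Proof.
have -> : l2_inner (0 : l2 R X) 0 = csum (fun _ : X => 0).
  by congr csum; apply/funext => x; rewrite /l2_fun raddf0 mul0r.
by rewrite /csum/= rsum0.
Qed.

End SquareSummable.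

(** * Invariant vectors in quasi-regular representations *)

Section QuasiRegularRepresentations.
Local Open Scope ring_scope.
Variables (R : realType) (gT : groupType).
Implicit Types P Q : set gT.

Definition base_coset P : coset_space P :=
  exist _ (lcoset P 1%g) (mem_set (imageP _ I)).

Lemma ltrans_base_coset P p : P 1%g ->
  (forall q r, P q -> P r -> P (q * r)%g) -> (forall q, P q -> P q^-1%g) ->
  P p -> ltrans p (base_coset P) = base_coset P.
Proof.
move=> P1 PM PV Pp; apply/val_inj/seteqP; split => x /=.
  by move=> [_ [q Pq <-] <-]; exists (p * q)%g; [exact: PM|rewrite !mul1g].
move=> [q Pq <-]; exists (p^-1 * q)%g; last by rewrite mulVKg mul1g.
by exists (p^-1 * q)%g; [apply: PM => //; exact: PV|rewrite mul1g].
Qed.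

Lemma quasi_regular_delta P g c :
  quasi_regular R P g (l2_delta R c) = l2_delta R (ltrans g c).
Proof.
apply/val_inj/funext => d /=; rewrite /l2_fun /=.
by congr (_ %:R); congr nat_of_bool; apply/eqP/eqP => [<-|->];
  rewrite -ltransM (mulgV, mulVg) ltrans1.
Qed.

(** The indicator of the coset [P] is a [P]-invariant vector of norm one in
    [l2 (G/P)]; its image under an isometric intertwiner is [P]-invariant, hence
    constant on the [P]-orbits in [G/Q], hence zero as these are infinite. *)
Lemma infinite_orbits_not_equivalent P Q : P 1%g ->
  (forall p q, P p -> P q -> P (p * q)%g) -> (forall p, P p -> P p^-1%g) ->
  (forall c : coset_space Q, exists k : nat -> gT,
     (forall i, P (k i)) /\ injective (fun i => ltrans (k i) c)) ->
  ~ unitarily_equivalent (quasi_regular R P) (quasi_regular R Q).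
Proof.
move=> P1 PM PV orbP [U [[U_inner _] UE]].
pose f : l2 R (coset_space Q) := U (l2_delta R (base_coset P)).
have f_inv p c : P p -> f (ltrans p c) = f c.
  move=> Pp; have /(congr1 (fun h : l2 R (coset_space Q) => h (ltrans p c))) :
      quasi_regular R Q p f = f.
    by rewrite /f -UE quasi_regular_delta ltrans_base_coset.
  by rewrite /= {1}/l2_fun/= -ltransM mulVg ltrans1.
have f0 : f = 0.
  apply/val_inj/funext => c; have [k [kP kI]] := orbP c.
  rewrite raddf0.
  apply: (@sq_summable_infinite_fiber R _ (val f) _ _ _ kI) => [|i].
    exact/asboolP/(valP f).
  exact: f_inv.
have := U_inner (l2_delta R (base_coset P)) (l2_delta R (base_coset P)).
by rewrite -/f f0 l2_inner0 l2_inner_delta => /esym/eqP; rewrite oner_eq0.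
Qed.

End QuasiRegularRepresentations.

(** * Parabolic subgroups *)

Lemma parabolics_not_equivalent (R : realType) (Sigma : finType)
    (G : groupClosed (tree_aut Sigma)) (e e' : nat -> Sigma) :
  weakly_branch G -> spherically_transitive G ->
  (forall g : tree_aut Sigma, g \in G -> ray_act g e' <> e) ->
  ~ unitarily_equivalent (quasi_regular R (ray_stab G e))
                         (quasi_regular R (ray_stab G e')).
Proof.
move=> wbG stG ee'; apply: infinite_orbits_not_equivalent.
- exact: ray_act1.
- by move=> p q pe qe; rewrite /ray_stab/= ray_actM qe.
- by move=> p pe; rewrite /ray_stab/= -{1}pe ray_actK.
move=> c; have [g _ gc] := set_mem (valP c).
have [k [kG ke kI]] := stab_orbit_infinite wbG stG (ee' _ (valP g)).
pose K i : subgroup_of G := exist _ (k i) (kG i).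
exists K; split=> [i|i j Kij]; first exact: ke.
(* [K i] and [K j] translate the coset [c] of [g] to the same coset, so they
   translate the point [g e'] of the orbit of [e'] to the same ray. *)
apply: kI; have : val (ltrans (K i) c) (K i * g)%g.
  by exists g => //; rewrite -gc; exists 1%g; [exact: ray_act1|rewrite mulg1].
rewrite Kij => -[z]; rewrite -gc => -[q qe <-].
move=> /(congr1 (fun h => ray_act (val h) e')).
by rewrite /= !ray_actM qe.
Qed.

(** The only ray fixed by the stabilizer of [e] is [e]. *)
Lemma ray_stab_inj (Sigma : finType) (G : groupClosed (tree_aut Sigma)) :
  weakly_branch G -> spherically_transitive G -> injective (ray_stab G).
Proof.
move=> wbG stG e x ex; apply: contrapT => /nesym xe.
have [k [kG ke kI]] := stab_orbit_infinite wbG stG xe.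
have kx i : ray_act (k i) x = x.
  have : ray_stab G e (exist _ (k i) (kG i)) by exact: ke.
  by rewrite ex.
by have := kI 0 1; rewrite !kx => /(_ erefl).
Qed.

Lemma rays_uncountable (T : Type) (a b : T) :
  a <> b -> ~ countable [set: nat -> T].
Proof.
move=> ab /countable_injP[f /in2TT fI].
(* Cantor's diagonal: [d] differs from every [e] at the index [f e]. *)
pose d n := if `[< exists e, f e = n /\ e n = a >] then b else a.
have [[e [/fI -> ]]|nd] := pselect (exists e, f e = f d /\ e (f d) = a).
  move=> da.
  have : d (f d) = b by rewrite /d; case: asboolP => // -[]; exists d.
  by rewrite da.
have da : d (f d) = a by rewrite {1}/d; case: asboolP.
by apply: nd; exists d.
Qed.

Theorem theorem9p6 (R : realType) (Sigma : finType)
    (G : groupClosed (tree_aut Sigma)) :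
  countable [set g : tree_aut Sigma | g \in G] ->
  weakly_branch G ->
  spherically_transitive G ->
  exists Ps : set (set (subgroup_of G)),
    [/\ Ps `<=` parabolic G,
        ~ countable Ps &
        forall P Q, Ps P -> Ps Q -> P <> Q ->
          ~ unitarily_equivalent (quasi_regular R P) (quasi_regular R Q)].
Proof.
move=> cG wbG stG; have [a [b ab]] := weakly_branch_two_letters wbG.
pose orb e := [set ray_act g e | g in [set g : tree_aut Sigma | g \in G]].
have orb_eq e e' : orb e e' -> orb e = orb e'.
  move=> [g gG <-]; apply/seteqP; split=> [_ [h hG <-]|_ [h hG <-]].
    exists (h * g^-1)%g; last by rewrite ray_actM ray_actK.
    by rewrite /= gpredM ?gpredV.
  by exists (h * g)%g; [exact: gpredM|rewrite ray_actM].
(* With a default value independent of [e], [rep e] depends only on the set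
   [orb e]. *)
pose rep e := xget (fun=> a) (orb e).
have orb_rep e : orb e (rep e).
  by apply: xgetPex; exists e; exists 1%g; [exact: gpred1|exact: ray_act1].
have rep_eq e e' : orb (rep e) (rep e') -> rep e = rep e'.
  move=> /orb_eq ee'.
  by rewrite /rep (orb_eq _ _ (orb_rep e)) ee' -(orb_eq _ _ (orb_rep e')).
exists (range (ray_stab G \o rep)); split.
- by move=> _ [e _ <-]; exists (rep e).
- (* Otherwise the rays would be a countable union of sets, each inside one
     countable orbit. *)
  move=> cP; apply: (rays_uncountable ab).
  have -> : [set: nat -> Sigma] =
      \bigcup_(P in range (ray_stab G \o rep)) [set e | ray_stab G (rep e) = P].
    apply/seteqP; split=> // e _.
    by exists (ray_stab G (rep e)) => //; exists e.
  apply: bigcup_countable => // _ [e _ <-].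
  apply: (@sub_countable _ _ _ (orb e)); last first.
    exact: (sub_countable (card_image_le _ _)).
  apply: subset_card_le => e' /= /(ray_stab_inj wbG stG) ee'.
  rewrite (orb_eq _ _ (orb_rep e)) -ee' -(orb_eq _ _ (orb_rep e')).
  by exists 1%g; [exact: gpred1|exact: ray_act1].
- move=> _ _ [e _ <-] [e' _ <-] PQ.
  apply: parabolics_not_equivalent => // g gG ge.
  by apply: PQ; rewrite /= (rep_eq e' e)//; exists g.
Qed.
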